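(* Let $\Phi\in\mathcal G'$, $\alpha\in(0,1)$ and $m\in\mathbb N$. Then $\Phi\in\mathcal D^{-m-\alpha,2}$ if and only if \[ \frac{1}{\Gamma(\alpha)}\int_0^1\frac{1}{(1-\lambda_{m+1})^{1-\alpha}}\int_0^{\lambda_{m+1}}\cdots\int_0^{\lambda_2}\int_{\mathcal S'_{\mathbb C}}|S\Phi(\lambda_1u)|^2\,d\nu(u)\,d\lambda_1\cdots d\lambda_{m+1}<\infty . \] (For $m=0$ this reads $\frac{1}{\Gamma(\alpha)}\int_0^1(1-\lambda_1)^{\alpha-1}\int|S\Phi(\lambda_1u)|^2d\nu(u)\,d\lambda_1<\infty$.)
   Context: Let $\mu$ be the white noise measure on the tempered distributions $\mathcal S'$ (Gaussian with $\int e^{i\langle\xi,x\rangle}d\mu=e^{-|\xi|^2/2}$, $\xi\in\mathcal S$, $|\cdot|$ the $L^2$ norm). For $s\in\mathbb R$, $\mathcal G_s$ is the space of formal chaos series $\Phi=\sum_{n\ge0}\langle\Phi^{(n)},:\cdot^{\otimes n}:\rangle$ (Wick-ordered monomials / multiple Wiener integrals) with symmetric kernels $\Phi^{(n)}\in L^2(\mathbb R^n,dx)_{\mathbb C}$ and $\sum_n2^{2sn}n!|\Phi^{(n)}|^2<\infty$, and $\mathcal G'=\bigcup_{q\in\mathbb N}\mathcal G_{-q}$. The $S$-transform is $S\Phi(h)=\sum_n\langle\Phi^{(n)},h^{\otimes n}\rangle$, $h\in\mathcal S_{\mathbb C}$. Let $\nu$ be the Gaussian measure on $\mathcal S'_{\mathbb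 C}$ with $\int\exp(i\,\mathrm{Re}\langle h,\bar u\rangle)d\nu(u)=\exp(-\tfrac14\langle h,\bar h\rangle)$; the monomials $u\mapsto\langle\Phi^{(n)},u^{\otimes n}\rangle$ are defined in $L^2(\nu)$, orthogonal for different $n$, with $\int|\langle\Phi^{(n)},u^{\otimes n}\rangle|^2d\nu=n!|\Phi^{(n)}|^2$, and $S\Phi(\lambda u):=\sum_n\lambda^n\langle\Phi^{(n)},u^{\otimes n}\rangle$, so that $\lambda\mapsto\int|S\Phi(\lambda u)|^2d\nu(u)\in[0,\infty]$ is defined. For $\beta\in\mathbb R$, $\Phi\in\mathcal G'$ belongs to $\mathcal D^{\beta,2}$ iff $\sum_{n}(1+n^\beta)\,n!\,|\Phi^{(n)}|^2<\infty$ (for $\beta<0$ only the terms $n\ge1$ matter for this convergence).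
   Formalization: For β<0, membership in D^{β,2} is taken with weight n^β (n≥1) instead of 1+n^β; with the literal weight the claim fails, e.g. for n!|Φ^(n)|²=1/n. The Gaussian monomials enter only through their stated orthogonality and norms. *)

(* Defs.v *)
From HB Require Import structures.
From mathcomp Require Import all_boot all_order all_algebra.
From mathcomp Require Import all_classical all_reals all_analysis.
Set Implicit Arguments. Unset Strict Implicit. Unset Printing Implicit Defensive.
Import Order.TTheory GRing.Theory Num.Theory.
Import numFieldNormedType.Exports.
Local Open Scope classical_set_scope.
Local Open Scope ring_scope.
Local Open Scope ereal_scope.

Definition Gamma (R : realType) (a : R) : R :=
  fine (\int[@lebesgue_measure R]_(t in `]0%R, +oo[) ((t `^ (a - 1)) * expR (- t))%:E).

(* Abstract chaos model of Phi in G'.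
   knorm n = |Phi^(n)|_{L^2(R^n)};
   Pre n, Pim n = real and imaginary parts of the monomial u |-> <Phi^(n), u^{(x)n}>
   on the probability space (Omega, nu). *)
Definition chaos_model (R : realType) (d : measure_display) (Omega : measurableType d)
  (nu : {measure set Omega -> \bar R}) (knorm : nat -> R) (Pre Pim : nat -> Omega -> R) : Prop :=
  (forall n, 0 <= knorm n)%R /\
  (forall n, measurable_fun setT (Pre n) /\ measurable_fun setT (Pim n)) /\
  (forall n, nu.-integrable setT (fun u => ((Pre n u) ^+ 2)%:E) /\
             nu.-integrable setT (fun u => ((Pim n u) ^+ 2)%:E)) /\
  (forall n, \int[nu]_u (((Pre n u) ^+ 2 + (Pim n u) ^+ 2)%R)%:E
             = ((n`!)%:R * knorm n ^+ 2)%:E) /\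
  (forall n m, n <> m ->
     \int[nu]_u ((Pre n u * Pre m u + Pim n u * Pim m u)%R)%:E = 0 /\
     \int[nu]_u ((Pim n u * Pre m u - Pre n u * Pim m u)%R)%:E = 0).

Definition in_Gdual (R : realType) (knorm : nat -> R) : Prop :=
  exists q : nat,
    \sum_(0 <= n <oo) (((2 ^+ (2 * q * n))^-1 * (n`!)%:R * knorm n ^+ 2)%R)%:E < +oo.

Definition in_D2 (R : realType) (beta : R) (knorm : nat -> R) : Prop :=
  \sum_(1 <= n <oo) (((n%:R) `^ beta * (n`!)%:R * knorm n ^+ 2)%R)%:E < +oo.

(* lambda |-> int |S Phi(lambda u)|^2 dnu(u) in [0, +oo]: limit of the L^2(nu)
   norms of the partial sums sum_{n<N} lambda^n <Phi^(n), u^{(x)n}>. *)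
Definition SPhi_sq (R : realType) (d : measure_display) (Omega : measurableType d)
  (nu : {measure set Omega -> \bar R}) (Pre Pim : nat -> Omega -> R) (l : R) : \bar R :=
  limn (fun N : nat => \int[nu]_u
     (((\sum_(n < N) l ^+ n * Pre n u) ^+ 2 + (\sum_(n < N) l ^+ n * Pim n u) ^+ 2)%R)%:E).

Fixpoint iter_int (R : realType) (F : R -> \bar R) (k : nat) : R -> \bar R :=
  match k with
  | 0%N => F
  | k'.+1 => fun l => \int[@lebesgue_measure R]_(x in `[0%R, l]) iter_int F k' x
  end.

(* Main.v *)
Require Import Defs.
From HB Require Import structures.
From mathcomp Require Import all_boot all_order all_algebra.
From mathcomp Require Import all_classical all_reals all_analysis.
From mathcomp Require Import measurable_realfun zify ring lra.
Import Order.TTheory GRing.Theory Num.Theory.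
Import numFieldNormedType.Exports.
Local Open Scope classical_set_scope.
Local Open Scope ring_scope.
Local Open Scope ereal_scope.

(* Put c_n = n! |Phi^(n)|^2. By orthogonality of the monomials the inner
   integral is the power series sum_n c_n l^(2n), and integrating it term by
   term turns the whole iterated integral into
     sum_n c_n / ((2n+1) ... (2n+m)) * B_(2n+m),
   where B_N = int_0^1 (1-l)^(alpha-1) l^N dl. Cutting B_N at distance 1/(N+1)
   from 1 shows that B_N is comparable to (N+1)^(-alpha), so the coefficient of
   c_n is comparable to n^(-m-alpha); the term n = 0 is finite in any case.
   The prefactor is harmless because 0 < Gamma(alpha) < +oo. *)

(** * Integrals of powers, possibly singular at an endpoint *)

Lemma is_derive1_continuous (R : realType) (f : R -> R) (x df : R) :
  is_derive x 1%R f df -> {for x, continuous f}.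
Proof.
by move=> h; apply: differentiable_continuous; apply/derivable1_diffP; case: h.
Qed.

(* Only interior increments of F are bounded: f may blow up at the endpoints. *)
Lemma ge0_integral_itvoo_le (R : realType) (f F : R -> R) (a b M : R) :
  (a < b)%R ->
  measurable_fun `]a, b[ f ->
  (forall x, x \in `]a, b[ -> 0 <= f x)%R ->
  (forall x, x \in `]a, b[ -> {for x, continuous f}) ->
  (forall x, x \in `]a, b[ -> is_derive x 1%R F (f x)) ->
  (forall u v, a < u -> u < v -> v < b -> F v - F u <= M)%R ->
  \int[@lebesgue_measure R]_(x in `]a, b[) (f x)%:E <= M%:E.
Proof.
move=> ab mf f0 cf dF FM.
(* The open interval is exhausted by the closed intervals [[a + e k, b - e k]]. The denominator k+3
   gives 2 e k < b - a, so even the first of them is nondegenerate. *)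
pose e (k : nat) : R := ((b - a) / k.+3%:R)%R.
have ba0 : (0 < b - a)%R by rewrite subr_gt0.
have e0 k : (0 < e k)%R by rewrite /e divr_gt0.
have e2 k : (e k + e k < b - a)%R.
  rewrite /e -mulrDr gtr_pMr// -mulr2n -[X in (X < _)%R]mulr_natl ltr_pdivrMr//.
  by rewrite mul1r ltr_nat.
have eS k l : (k <= l)%N -> (e l <= e k)%R.
  by move=> kl; rewrite /e ler_pM2l// lef_pV2 ?posrE// ler_nat.
pose A k : set R := `[(a + e k)%R, (b - e k)%R]%classic.
have AE k x : A k x = (a + e k <= x <= b - e k)%R by rewrite /A /= in_itv.
have Asub k : A k `<=` `]a, b[.
  move=> x; rewrite AE => /andP[x1 x2]; rewrite /= in_itv/=.
  by have ek := e0 k; apply/andP; split; lra.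
have UA : \bigcup_k A k = `]a, b[%classic.
  apply/seteqP; split => [x [k _ /Asub]//|x /=].
  rewrite in_itv/= => /andP[ax xb].
  have m0 : (0 < Num.min (x - a) (b - x))%R by rewrite lt_min !subr_gt0 ax xb.
  (* The point x lies in [A k] once [e k] is at most its distance to both endpoints. *)
  have [k kP] : exists k : nat, ((b - a) / Num.min (x - a) (b - x) < k%:R)%R.
    by exists (Num.bound ((b - a) / Num.min (x - a) (b - x)))%R;
      rewrite archi_boundP// ltW// divr_gt0.
  exists k => //; rewrite AE.
  have : (e k <= Num.min (x - a) (b - x))%R.
    rewrite /e ler_pdivrMr// -ler_pdivrMl// mulrC (le_trans (ltW kP))// ler_nat.
    by rewrite !leqW.
  by rewrite le_min => /andP[h1 h2]; apply/andP; split; lra.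
rewrite -UA.
have mA k : measurable_fun (A k) (EFin \o f).
  by apply/measurable_EFinP; apply: measurable_funS mf => //; exact: Asub.
(* By monotone convergence it suffices to bound the integral over each [A k]. There the fundamental
   theorem of calculus gives an increment of F between two interior points. *)
have cv : \int[@lebesgue_measure R]_(x in A i) (f x)%:E @[i --> \oo] -->
    \int[@lebesgue_measure R]_(x in \bigcup_i A i) (f x)%:E.
  apply: ge0_nondecreasing_set_cvg_integral => //.
  - apply/nondecreasing_seqP => k; rewrite subsetEset => x.
    rewrite !AE => /andP[x1 x2]; have ek := eS _ _ (leqnSn k); apply/andP; split; lra.
  - by move=> k; exact: measurable_itv.
  - by move=> k x /Asub xab; rewrite lee_fin f0.
rewrite -(cvg_lim _ cv)//; apply: lime_le; first by apply/cvg_ex; eexists; exact: cv.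
near=> k.
rewrite (@continuous_FTC2 _ f F).
- rewrite -EFinB lee_fin FM//; have ek := e0 k; have ek2 := e2 k; lra.
- have ek2 := e2 k; lra.
- apply: continuous_in_subspaceT => x; rewrite inE => /Asub xab; exact: cf.
- have dc x : x \in `]a, b[ -> {for x, continuous F}.
    by move=> /dF; exact: is_derive1_continuous.
  split => [x|//|].
  + by move=> /subset_itv_oo_cc/Asub/dF[].
  + by apply: cvg_at_right_filter; apply: dc; have ek := e0 k; have ek2 := e2 k;
       rewrite in_itv/=; apply/andP; split; lra.
  + by apply: cvg_at_left_filter; apply: dc; have ek := e0 k; have ek2 := e2 k;
       rewrite in_itv/=; apply/andP; split; lra.
- move=> x /subset_itv_oo_cc/Asub xab; rewrite derive1E; have h := dF x xab.
  exact: derive_val.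
Unshelve. all: by end_near. Qed.

Lemma is_derive_powR_onem (R : realType) (p x : R) : (x < 1)%R ->
  is_derive x 1%R (fun y : R => (1 - y) `^ p)%R (- (p * (1 - x) `^ (p - 1)))%R.
Proof.
move=> x1.
have h1 : is_derive (1 - x)%R 1%R (fun y : R => y `^ p)%R (p * (1 - x) `^ (p - 1))%R.
  by apply: is_derive1_powR; rewrite subr_gt0.
have h2 : is_derive x 1%R (fun y : R => 1 - y)%R (0 - 1)%R by exact: is_deriveB.
have := @is_derive1_comp R (fun y => y `^ p)%R (fun y => 1 - y)%R x _ _ h1 h2.
by rewrite sub0r mulrN1.
Qed.

(** The exponent p - 1 may be negative, but the antiderivative -(1-x)^p / p stays bounded near x = 1
    because p > 0. Its interior increments are at most a^p / p. *)
Lemma integral_powR_onem_le (R : realType) (p a : R) : (0 < p)%R -> (0 < a)%R ->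
  \int[@lebesgue_measure R]_(x in `](1 - a)%R, 1%R[) ((1 - x) `^ (p - 1))%:E
    <= (a `^ p / p)%:E.
Proof.
move=> p0 a0.
apply: (@ge0_integral_itvoo_le _ _ (fun x => - p^-1 * (1 - x) `^ p)%R).
- lra.
- apply: measurable_funTS; apply: (measurableT_comp (measurable_powR _)).
  exact: measurable_funB.
- by move=> x _; exact: powR_ge0.
- move=> x; rewrite in_itv/= => /andP[_ x1].
  exact: (is_derive1_continuous _ _ _ _ (is_derive_powR_onem _ _ _ x1)).
- move=> x; rewrite in_itv/= => /andP[_ x1].
  have h := is_derive_powR_onem _ p _ x1.
  apply: is_derive_eq; rewrite /GRing.scale/=.
  by rewrite mulrNN mulrA mulVf ?mul1r// gt_eqF.
- move=> u v au uv v1; rewrite !mulNr opprK addrC -mulrBr mulrC ler_pM2r ?invr_gt0//.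
  rewrite lerBlDr -[leLHS]addr0 lerD ?powR_ge0//.
  by rewrite ge0_ler_powR ?nnegrE//; lra.
Qed.

Lemma integral_powR_le (R : realType) (p a : R) : (0 < p)%R -> (0 < a)%R ->
  \int[@lebesgue_measure R]_(x in `]0%R, a[) (x `^ (p - 1))%:E <= (a `^ p / p)%:E.
Proof.
move=> p0 a0.
have d (x : R) : (0 < x)%R -> is_derive x 1%R (fun y : R => p^-1 * y `^ p)%R (x `^ (p - 1))%R.
  move=> x0; have h := is_derive1_powR p x0.
  apply: is_derive_eq; rewrite /GRing.scale/=.
  by rewrite mulrA mulVf ?mul1r// gt_eqF.
apply: (@ge0_integral_itvoo_le _ _ (fun x => p^-1 * x `^ p)%R) => //.
- by apply: measurable_funTS; exact: measurable_powR.
- by move=> x _; exact: powR_ge0.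
- move=> x; rewrite in_itv/= => /andP[x0 _].
  exact: (is_derive1_continuous _ _ _ _ (is_derive1_powR (p - 1) x0)).
- by move=> x; rewrite in_itv/= => /andP[x0 _]; exact: d.
- move=> u v u0 uv va; rewrite -mulrBr mulrC ler_pM2r ?invr_gt0//.
  rewrite lerBlDr -[leLHS]addr0 lerD ?powR_ge0//.
  by rewrite ge0_ler_powR ?nnegrE//; lra.
Qed.

Lemma integral_exprn (R : realType) (a b : R) (n : nat) : (a <= b)%R ->
  \int[@lebesgue_measure R]_(x in `[a, b]) (x ^+ n)%:E =
  ((b ^+ n.+1 - a ^+ n.+1) / n.+1%:R)%:E.
Proof.
rewrite le_eqVlt => /predU1P[->|ab].
  by rewrite set_itv1 integral_set1 subrr mul0r.
rewrite (@continuous_FTC2 _ _ (fun x : R => x ^+ n.+1 / n.+1%:R)%R)//.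
- by rewrite -EFinB mulrBl.
- by apply: continuous_in_subspaceT => x _; exact: exprn_continuous.
- have c (x : R) : {for x, continuous (fun x : R => x ^+ n.+1 / n.+1%:R)%R}.
    by apply: cvgM; [exact: exprn_continuous|exact: cvg_cst].
  split => [x _||].
  + by apply: derivableM => //; exact: exprn_derivable.
  + by apply: cvg_at_right_filter; exact: c.
  + by apply: cvg_at_left_filter; exact: c.
- move=> x _; rewrite derive1E deriveM// ?derive_cst ?exp_derive; last first.
    exact: exprn_derivable.
  rewrite scaler0 add0r/= /GRing.scale/= mulr1.
  by rewrite mulrA mulVf// mul1r.
Qed.

(** * Term-by-term iterated integration of a power series *)

(** All terms are nonnegative, so sum and integral commute even where the series diverges. Each
    integration raises the exponent by one and divides by the new exponent; after k of them the
    divisors (2n+1), ..., (2n+k) form the falling factorial. *)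
Lemma iter_intE (R : realType) (F : R -> \bar R) (c : nat -> R) (k : nat) (l : R) :
  (forall n, 0 <= c n)%R ->
  (forall x, (0 <= x)%R -> F x = \sum_(n <oo) (c n * x ^+ n.*2)%:E) ->
  (0 <= l)%R ->
  iter_int F k l =
  \sum_(n <oo) (c n / ((n.*2 + k) ^_ k)%:R * l ^+ (n.*2 + k))%:E.
Proof.
move=> c0 FE; elim: k l => [|k IH] l l0.
  by rewrite /= FE//; apply: eq_eseriesr => n _; rewrite addn0 ffactn0 divr1.
rewrite /=; under eq_integral.
  move=> x; rewrite inE/= in_itv/= => /andP[x0 _]; rewrite IH//; over.
rewrite integral_nneseries//=.
- apply: eq_eseriesr => n _.
  under eq_integral do rewrite EFinM.
  rewrite ge0_integralZl_EFin//=.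
  + rewrite integral_exprn// expr0n/= subr0 -EFinM addnS ffactSS natrM invfM.
    by congr EFin; ring.
  + by move=> x; rewrite in_itv/= => /andP[x0 _]; rewrite lee_fin exprn_ge0.
  + by apply/measurable_EFinP; exact: exprn_measurable.
  + by rewrite divr_ge0.
- move=> n; apply/measurable_EFinP; apply: measurable_funM => //.
- move=> n x; rewrite in_itv/= => /andP[x0 _].
  by rewrite lee_fin mulr_ge0 ?exprn_ge0// divr_ge0.
Qed.

(** * Two-sided bounds for the Beta integrals, and positivity of Gamma *)

Lemma le0_ler_powR (R : realType) (p x y : R) :
  (p <= 0)%R -> (0 < x)%R -> (x <= y)%R -> (y `^ p <= x `^ p)%R.
Proof.
move=> p0 x0 xy; have y0 := lt_le_trans x0 xy.
rewrite -oppr_ge0 in p0; move: (- p)%R (opprK p) p0 => q <- q0.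
by rewrite !powRN lef_pV2 ?posrE ?powR_gt0// ge0_ler_powR ?nnegrE// ltW.
Qed.

Lemma measurable_beta_integrand (R : realType) (p : R) (n : nat) (D : set R) :
  measurable_fun D (fun x : R => ((1 - x) `^ p * x ^+ n)%:E).
Proof.
apply/measurable_EFinP/measurable_funTS; apply: measurable_funM => //.
by apply: (measurableT_comp (measurable_powR _)); exact: measurable_funB.
Qed.

(** Cut at 1 - a with a = 1/(n+1). Left of the cut the weight is at most a^(p-1) and the integral of
    x^n is at most a, which contributes a^p. Right of it x^n <= 1 and the weight integrates to at
    most a^p / p. *)
Lemma beta_integral_le (R : realType) (p : R) (n : nat) : (0 < p < 1)%R ->
  \int[@lebesgue_measure R]_(x in `[0%R, 1%R[) ((1 - x) `^ (p - 1) * x ^+ n)%:E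
    <= ((1 + p^-1) * n.+1%:R `^ (- p))%:E.
Proof.
move=> /andP[p0 p1].
pose a : R := n.+1%:R^-1%R.
have a0 : (0 < a)%R by rewrite invr_gt0.
have a1 : (a <= 1)%R by rewrite invf_le1// ler1n.
have aE q : (n.+1%:R `^ (- q) = a `^ q)%R.
  by rewrite /a -powR_inv1// -powRrM mulN1r.
have -> : `[0%R, 1%R[%classic = `[0%R, (1 - a)%R] `|` `](1 - a)%R, 1%R[ :> set R.
  by rewrite -itv_bndbnd_setU// ?bnd_simp; lra.
rewrite ge0_integral_setU//=; last 3 first.
- exact: measurable_beta_integrand.
- move=> x [] /=; rewrite in_itv/= => /andP[x0 x1];
    rewrite lee_fin mulr_ge0 ?powR_ge0// exprn_ge0//; lra.
- apply/disj_setPS => x [] /=; rewrite !in_itv/= => /andP[_ h] /andP[h' _]; lra.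
rewrite aE mulrDl mul1r EFinD; apply: leeD; last first.
  rewrite (mulrC p^-1%R); apply: le_trans (integral_powR_onem_le _ _ _ p0 a0).
  apply: ge0_le_integral => //.
  - move=> x /=; rewrite in_itv/= => /andP[x0 x1].
    by rewrite lee_fin mulr_ge0 ?powR_ge0// exprn_ge0//; lra.
  - exact: measurable_beta_integrand.
  - apply/measurable_EFinP/measurable_funTS.
    by apply: (measurableT_comp (measurable_powR _)); exact: measurable_funB.
  - move=> x /=; rewrite in_itv/= => /andP[x0 x1].
    rewrite lee_fin ler_piMr ?powR_ge0// exprn_ile1//; lra.
(* Once the weight is replaced by the constant a^(p-1), the domain can be enlarged to [0, 1], where
   x^n integrates to exactly a. *)
apply: (@le_trans _ _ (\int[@lebesgue_measure R]_(x in `[0%R, 1%R])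
    ((a `^ (p - 1))%:E * (x ^+ n)%:E))).
  apply: (@le_trans _ _ (\int[@lebesgue_measure R]_(x in `[0%R, (1 - a)%R])
    ((a `^ (p - 1))%:E * (x ^+ n)%:E))).
    apply: ge0_le_integral => //.
    - move=> x /=; rewrite in_itv/= => /andP[x0 x1].
      by rewrite lee_fin mulr_ge0 ?powR_ge0// exprn_ge0//; lra.
    - exact: measurable_beta_integrand.
    - by apply/measurable_EFinP; apply: measurable_funM.
    - move=> x /=; rewrite in_itv/= => /andP[x0 x1].
      by rewrite lee_fin ler_wpM2r ?exprn_ge0// le0_ler_powR//; lra.
  apply: ge0_subset_integral => //.
  - by apply/measurable_EFinP; apply: measurable_funM.
  - move=> x /=; rewrite in_itv/= => /andP[x0 x1].
    by rewrite lee_fin mulr_ge0 ?powR_ge0// exprn_ge0//.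
  - by apply: subset_itvl; rewrite bnd_simp; lra.
rewrite ge0_integralZl_EFin//=; last 3 first.
- by move=> x; rewrite in_itv/= => /andP[x0 x1]; rewrite lee_fin exprn_ge0.
- by apply/measurable_EFinP; exact: exprn_measurable.
- exact: powR_ge0.
rewrite integral_exprn// expr1n expr0n/= subr0 mul1r -EFinM lee_fin.
by rewrite mulrC mulr_powRB1// ltW.
Qed.

(** Only the piece [1 - a, 1[ with a = 1/(n+1) is kept. There the weight is at least a^(p-1), since
    p < 1, and x^n integrates to a (1 - (1-a)^(n+1)), where (1-a)^(n+1) <= exp(-1). *)
Lemma beta_integral_ge (R : realType) (p : R) (n : nat) : (0 < p < 1)%R ->
  ((1 - expR (-1)) * n.+1%:R `^ (- p))%:E <=
  \int[@lebesgue_measure R]_(x in `[0%R, 1%R[) ((1 - x) `^ (p - 1) * x ^+ n)%:E.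
Proof.
move=> /andP[p0 p1].
pose a : R := n.+1%:R^-1%R.
have a0 : (0 < a)%R by rewrite invr_gt0.
have a1 : (a <= 1)%R by rewrite invf_le1// ler1n.
have aE q : (n.+1%:R `^ (- q) = a `^ q)%R.
  by rewrite /a -powR_inv1// -powRrM mulN1r.
apply: (@le_trans _ _ (\int[@lebesgue_measure R]_(x in `[(1 - a)%R, 1%R[)
    ((a `^ (p - 1))%:E * (x ^+ n)%:E))); last first.
  apply: (@le_trans _ _ (\int[@lebesgue_measure R]_(x in `[(1 - a)%R, 1%R[)
      ((1 - x) `^ (p - 1) * x ^+ n)%:E)).
    apply: ge0_le_integral => //.
    - move=> x /=; rewrite in_itv/= => /andP[x0 x1].
      by rewrite lee_fin mulr_ge0 ?powR_ge0// exprn_ge0//; lra.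
    - by apply/measurable_EFinP; apply: measurable_funM.
    - exact: measurable_beta_integrand.
    - move=> x /=; rewrite in_itv/= => /andP[x0 x1].
      by rewrite lee_fin ler_wpM2r ?exprn_ge0// ?le0_ler_powR//; lra.
  apply: ge0_subset_integral => //.
  - exact: measurable_beta_integrand.
  - move=> x /=; rewrite in_itv/= => /andP[x0 x1].
    by rewrite lee_fin mulr_ge0 ?powR_ge0// exprn_ge0//.
  - by apply: subset_itvr; rewrite bnd_simp; lra.
rewrite ge0_integralZl_EFin//=; last 3 first.
- move=> x; rewrite in_itv/= => /andP[x0 x1]; rewrite lee_fin exprn_ge0//; lra.
- by apply/measurable_EFinP; exact: exprn_measurable.
- exact: powR_ge0.
rewrite integral_itv_bndo_bndc; last first.
  by apply/measurable_EFinP; exact: exprn_measurable.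
rewrite integral_exprn; last lra.
rewrite expr1n -EFinM lee_fin aE [leRHS]mulrCA [leRHS]mulrC -/a.
rewrite [in leRHS](mulrC _ a) mulr_powRB1 ?(ltW a0)// mulrC.
rewrite ler_wpM2r ?powR_ge0// lerD2l lerN2.
(* (1 - a)^(n+1) <= exp(-a)^(n+1) = exp(-1) *)
rewrite (_ : -1 = - a * n.+1%:R)%R; last by rewrite mulNr mulVf.
rewrite expRM_natr lerXn2r ?nnegrE ?expR_ge0//; last exact: expR_ge1Dx.
by rewrite subr_ge0.
Qed.

(* Gamma is a [fine] of an integral, hence [0] if it diverged: convergence is
   part of this statement. *)
Lemma Gamma_gt0 (R : realType) (p : R) : (0 < p < 1)%R -> (0 < Gamma p)%R.
Proof.
move=> /andP[p0 p1]; apply: fine_gt0.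
have mG (D : set R) : measurable_fun D (fun t : R => (t `^ (p - 1) * expR (- t))%:E).
  apply/measurable_EFinP/measurable_funTS; apply: measurable_funM.
    exact: measurable_powR.
  by apply: measurableT_comp => //; exact: measurable_expR.
have G0 (x : R) : 0%E <= (x `^ (p - 1) * expR (- x))%:E.
  by rewrite lee_fin mulr_ge0 ?powR_ge0 ?expR_ge0.
apply/andP; split.
  (* Positivity: on [1, 2] both factors decrease, so the integrand is at least its value at 2. *)
  apply: (@lt_le_trans _ _ (\int[@lebesgue_measure R]_(x in `[1%R, 2%R])
      (2 `^ (p - 1) * expR (- 2))%:E)).
    rewrite integral_cst//= lebesgue_measure_itv/= lte_fin ltr1n/= -EFinB -EFinM.
    by rewrite lte_fin !mulr_gt0 ?powR_gt0 ?expR_gt0//; lra.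
  apply: (@le_trans _ _ (\int[@lebesgue_measure R]_(x in `[1%R, 2%R])
      (x `^ (p - 1) * expR (- x))%:E)).
    apply: ge0_le_integral => //; first exact: mG.
    move=> x /=; rewrite in_itv/= => /andP[x1 x2].
    rewrite lee_fin ler_pM ?powR_ge0 ?expR_ge0 ?ler_expR ?lerN2//.
    by rewrite le0_ler_powR//; lra.
  apply: ge0_subset_integral => //; first exact: mG.
  by move=> x /=; rewrite !in_itv/= andbT => /andP[x1 x2]; lra.
(* Finiteness: below 1 the integrand is dominated by t^(p-1), integrable since p > 0; above 1 by
   exp(-t), the exponential density of total mass 1. *)
have -> : `]0%R, +oo[%classic = `]0%R, 1%R[ `|` `[1%R, +oo[ :> set R.
  by rewrite -itv_bndbnd_setU ?bnd_simp.
rewrite ge0_integral_setU//=; last 2 first.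
- exact: mG.
- by apply/disj_setPS => x [] /=; rewrite !in_itv/= andbT => /andP[_ h] h'; lra.
apply: lte_add_pinfty.
  apply: (@le_lt_trans _ _ (1 `^ p / p)%:E); last by rewrite ltry.
  apply: le_trans (integral_powR_le _ _ _ p0 ltr01).
  apply: ge0_le_integral => //.
  - exact: mG.
  - by apply/measurable_EFinP/measurable_funTS; exact: measurable_powR.
  - move=> x /=; rewrite in_itv/= => /andP[x0 x1].
    by rewrite lee_fin ler_piMr ?powR_ge0// expR_le1; lra.
apply: (@le_lt_trans _ _ 1%E); last by rewrite ltry.
rewrite -(@integral_exponential_pdf R 1)//.
apply: (@le_trans _ _ (\int[@lebesgue_measure R]_(x in `[1%R, +oo[)
      (exponential_pdf 1 x)%:E)).
  apply: ge0_le_integral => //.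
  - exact: mG.
  - by apply/measurable_EFinP/measurable_funTS; exact: measurable_exponential_pdf.
  - move=> x /=; rewrite in_itv/= andbT => x1.
    rewrite lee_fin /exponential_pdf patchE mem_set/=; last first.
      by rewrite in_itv/= andbT; lra.
    rewrite mul1r mulN1r ler_piMl ?expR_ge0//.
    rewrite (le_trans (le0_ler_powR _ _ _ _ _ ltr01 x1)) ?powR1//; lra.
apply: ge0_subset_integral => //.
- by apply/measurable_EFinP; exact: measurable_exponential_pdf.
- by move=> x _; rewrite lee_fin exponential_pdf_ge0.
Qed.

(** * The inner integral as a power series *)

Lemma square_integrable_prod (R : realType) (d : measure_display) (Omega : measurableType d)
  (nu : {measure set Omega -> \bar R}) (f g : Omega -> R) :
  measurable_fun setT f -> measurable_fun setT g ->
  nu.-integrable setT (fun u => ((f u) ^+ 2)%:E) ->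
  nu.-integrable setT (fun u => ((g u) ^+ 2)%:E) ->
  nu.-integrable setT (fun u => (f u * g u)%:E).
Proof.
move=> mf mg f2 g2.
apply: le_integrable (integrableD measurableT f2 g2) => //.
- by apply/measurable_EFinP; exact: measurable_funM.
- move=> u _; rewrite /= lee_fin normrM [leRHS]ger0_norm ?addr_ge0 ?sqr_ge0//.
  rewrite -(real_normK (num_real (f u))) -(real_normK (num_real (g u))).
  (* This square yields 2|fg| <= f^2 + g^2, more than the domination by f^2 + g^2 asks for. *)
  have := sqr_ge0 (`|f u| - `|g u|)%R.
  have : (0 <= `|f u| * `|g u|)%R by rewrite mulr_ge0.
  nra.
Qed.

(** The partial sums agree for every N, so the two limits coincide. With z_n = [Pre n] + i [Pim n]
    and l real, the squared modulus of the sum of l^n z_n is the double sum of l^(i+j) Re(z_i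
    conj(z_j)), and orthogonality leaves its diagonal. *)
Lemma SPhi_sqE (R : realType) (d : measure_display) (Omega : measurableType d)
  (nu : {measure set Omega -> \bar R}) (knorm : nat -> R) (Pre Pim : nat -> Omega -> R) (l : R) :
  chaos_model nu knorm Pre Pim ->
  SPhi_sq nu Pre Pim l = \sum_(n <oo) ((n`!)%:R * knorm n ^+ 2 * l ^+ n.*2)%:E.
Proof.
move=> [_ [mP [iP [nP oP]]]].
apply: congr_lim; apply/funext => N.
(* [P i j] is the real part of z_i conj(z_j). It can be negative, so exchanging sum and integral
   below requires integrability rather than mere nonnegativity. *)
pose P i j u := (Pre i u * Pre j u + Pim i u * Pim j u)%R.
have iPP i j : nu.-integrable setT (fun u => (P i j u)%:E).
  have [[mr mi] [mr' mi']] := (mP i, mP j).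
  have [[ir ii] [ir' ii']] := (iP i, iP j).
  have := integrableD measurableT (square_integrable_prod _ _ _ _ _ _ mr mr' ir ir')
    (square_integrable_prod _ _ _ _ _ _ mi mi' ii ii').
  exact: eq_integrable.
have oPP i j : \int[nu]_u (P i j u)%:E =
    (if i == j then (i`!)%:R * knorm i ^+ 2 else 0)%:E.
  case: eqP => [<-|/oP[]//].
  by rewrite -nP; apply: eq_integral => u _; rewrite /P !expr2.
transitivity (\int[nu]_u \sum_(i < N) \sum_(j < N)
   ((l ^+ (i + j))%:E * (P i j u)%:E)).
  apply: eq_integral => u _.
  rewrite !expr2 !big_distrlr/= -big_split/= -sumEFin; apply: eq_bigr => i _.
  rewrite -big_split/= -sumEFin; apply: eq_bigr => j _.
  rewrite -EFinM /P exprD; congr EFin; ring.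
have iE (i j : 'I_N) : nu.-integrable setT (fun u => (l ^+ (i + j))%:E * (P i j u)%:E).
  exact: integrableZl.
rewrite integral_sum//=; last by move=> i; apply: integrable_sum => // j _.
rewrite big_mkord; apply: eq_bigr => i _.
rewrite integral_sum//= (bigD1 i)//= big1 ?adde0 => [|j ji].
  by rewrite integralZl// oPP eqxx -EFinM -addnn mulrC.
by rewrite integralZl// oPP ifF ?mule0// eq_sym; exact: negbTE.
Qed.

(** * Comparison of coefficients and of series *)

(** Each of the m factors 2n+1, ..., 2n+m lies between n and (m+3)n when n > 0. The constant m+3 is
    chosen so that (m+3)n also dominates 2n+m+1, the base in the Beta bounds at exponent 2n+m; one
    constant then serves both estimates. *)
Lemma ffact_bounds (n m : nat) : (0 < n)%N ->
  (n ^ m <= (n.*2 + m) ^_ m <= (m.+3 * n) ^ m)%N.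
Proof.
move=> n0.
have lo k : (n ^ k <= (n.*2 + k) ^_ k)%N.
  elim: k => [|k IH]; first by rewrite ffactn0.
  by rewrite addnS ffactSS expnS leq_mul//; lia.
have up k N : (n.*2 + k <= N -> (n.*2 + k) ^_ k <= N ^ k)%N.
  elim: k => [|k IH] h; first by rewrite ffactn0.
  by rewrite addnS ffactSS expnS leq_mul ?IH//; lia.
by rewrite lo up//; nia.
Qed.

Lemma nneseries_lty_le (R : realType) (u v : nat -> R) (c : R) : (0 <= c)%R ->
  (forall n, 0 <= u n)%R -> (forall n, 0 <= v n)%R -> (forall n, v n <= c * u n)%R ->
  \sum_(n <oo) (u n)%:E < +oo -> \sum_(n <oo) (v n)%:E < +oo.
Proof.
move=> c0 u0 v0 vu uoo; apply: (@le_lt_trans _ _ (\sum_(n <oo) (c%:E * (u n)%:E))).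
  by apply: lee_nneseries => [n _ _|n _]; rewrite -?EFinM lee_fin.
rewrite nneseriesZl => [|n _]; last by rewrite lee_fin.
have : \sum_(n <oo) (u n)%:E \is a fin_num.
  by rewrite ge0_fin_numE//; apply: nneseries_ge0 => n _ _; rewrite lee_fin.
by move=> /fineK <-; rewrite -EFinM ltry.
Qed.

(** The sums start at different indices: the term [v 0] is a real number, so splitting it off does
    not affect finiteness, and the comparison is only required from index 1 on. *)
Lemma nneseries_lty_equiv (R : realType) (u v : nat -> R) (c C : R) :
  (0 < c)%R -> (0 <= C)%R -> (forall n, 0 <= u n)%R -> (forall n, 0 <= v n)%R ->
  (forall n, (0 < n)%N -> c * u n <= v n <= C * u n)%R ->
  \sum_(1 <= n <oo) (u n)%:E < +oo <-> \sum_(n <oo) (v n)%:E < +oo.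
Proof.
move=> c0 C0 u0 v0 uv.
rewrite nneseries_recl//; last by move=> k _; rewrite lee_fin.
rewrite -[X in X < _ <-> _](nneseries_addn 1); last by move=> k; rewrite lee_fin.
rewrite -[X in _ + X](nneseries_addn 1); last by move=> k; rewrite lee_fin.
split => h.
  apply: lte_add_pinfty; first by rewrite ltry.
  apply: nneseries_lty_le C0 _ _ _ h => // n.
  by have /andP[] := uv (n + 1)%N (ltn_addl n (ltn0Sn 0)).
apply: (@nneseries_lty_le _ (fun n => v (n + 1)%N) _ c^-1) => //.
- by rewrite invr_ge0 ltW.
- move=> n; rewrite ler_pdivlMl//.
  by have /andP[] := uv (n + 1)%N (ltn_addl n (ltn0Sn 0)).
- by apply: le_lt_trans h; rewrite leeDr// lee_fin; exact: v0.
Qed.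

(** Nonnegativity again permits the exchange of sum and integral, with no convergence assumption on
    the series for G. *)
Lemma outer_integralE (R : realType) (c : nat -> R) (G : R -> \bar R) (p : R) (m : nat) :
  (forall n, 0 <= c n)%R ->
  (forall l, (0 <= l)%R -> G l = \sum_(n <oo) (c n * l ^+ (n.*2 + m))%:E) ->
  \int[@lebesgue_measure R]_(l in `[0%R, 1%R[) (((1 - l) `^ p)%:E * G l) =
  \sum_(n <oo) ((c n)%:E *
    \int[@lebesgue_measure R]_(l in `[0%R, 1%R[) ((1 - l) `^ p * l ^+ (n.*2 + m))%:E).
Proof.
move=> c0 GE.
have term0 n (l : R) : (0 <= l)%R -> 0 <= ((1 - l) `^ p * l ^+ (n.*2 + m))%:E.
  by move=> l0; rewrite lee_fin mulr_ge0 ?powR_ge0// exprn_ge0.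
transitivity (\int[@lebesgue_measure R]_(l in `[0%R, 1%R[)
    \sum_(n <oo) ((c n)%:E * ((1 - l) `^ p * l ^+ (n.*2 + m))%:E)).
  apply: eq_integral => l; rewrite inE/= in_itv/= => /andP[l0 _].
  rewrite GE// -nneseriesZl; last by move=> n _; rewrite lee_fin mulr_ge0// exprn_ge0.
  by apply: eq_eseriesr => n _; rewrite -!EFinM mulrCA.
rewrite integral_nneseries//=.
- apply: eq_eseriesr => n _; rewrite ge0_integralZl_EFin//=.
  + by move=> l; rewrite in_itv/= => /andP[l0 _]; exact: term0.
  + exact: measurable_beta_integrand.
- move=> n; apply/measurable_EFinP; apply: measurable_funM => //.
  by apply/measurable_EFinP; exact: measurable_beta_integrand.
- by move=> n l; rewrite in_itv/= => /andP[l0 _]; rewrite mule_ge0 ?lee_fin//; exact: term0.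
Qed.

Lemma powR_natrB (R : realType) (x p : R) (m : nat) : (0 < x)%R ->
  (x `^ (- m%:R - p) = (x ^+ m)^-1 * x `^ (- p))%R.
Proof.
move=> x0; rewrite powRD; last by rewrite (gt_eqF x0) implybT.
by rewrite powR_invn ?ltW.
Qed.

(** The Beta integral supplies the factor of order (2n+m+1)^(-p) and the falling factorial the
    factor of order n^(-m). Negative powers reverse inequalities, so the lower bound comes from
    2n+m+1 <= (m+3)n and the upper one from n <= 2n+m+1. *)
Lemma beta_coef_bounds (R : realType) (p b : R) (m n : nat) :
  (0 < p < 1)%R -> (0 < n)%N ->
  \int[@lebesgue_measure R]_(l in `[0%R, 1%R[)
    ((1 - l) `^ (p - 1) * l ^+ (n.*2 + m))%:E = b%:E ->
  ((1 - expR (-1)) * m.+3%:R `^ (- m%:R - p) * n%:R `^ (- m%:R - p)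
    <= b / ((n.*2 + m) ^_ m)%:R
    <= (1 + p^-1) * n%:R `^ (- m%:R - p))%R.
Proof.
move=> p01 n0 bE; have /andP[p0 p1] := p01.
have := beta_integral_le R p (n.*2 + m) p01; rewrite bE lee_fin => b_le.
have := beta_integral_ge R p (n.*2 + m) p01; rewrite bE lee_fin => b_ge.
have /andP[F1 F2] := ffact_bounds n m n0.
have nR : (0 < n%:R :> R)%R by rewrite ltr0n.
have FR : (0 < ((n.*2 + m) ^_ m)%:R :> R)%R by rewrite ltr0n ffact_gt0 leq_addl.
have Np0 : (- p <= 0)%R by rewrite oppr_le0 ltW.
have k0 : (0 < 1 - expR (-1) :> R)%R by rewrite subr_gt0 expR_lt1; lra.
apply/andP; split.
- rewrite -mulrA -powRM// -natrM powR_natrB; last by rewrite ltr0n muln_gt0.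
  rewrite mulrCA mulrC ler_pM//.
  + apply: le_trans b_ge; rewrite ler_pM2l// le0_ler_powR// ler_nat.
    by nia.
  + by rewrite lef_pV2 ?posrE// -natrX ?ler_nat// ltr0n expn_gt0 muln_gt0 n0.
- rewrite powR_natrB// mulrCA [leRHS]mulrC ler_pM//.
  + by apply: le_trans b_ge; rewrite mulr_ge0 ?powR_ge0// ltW.
  + apply: (le_trans b_le); rewrite ler_pM2l ?ltr_wpDl ?invr_gt0//.
    by rewrite le0_ler_powR// ler_nat; lia.
  + by rewrite lef_pV2 ?posrE ?exprn_gt0// -natrX ler_nat.
Qed.

(** * The equivalence *)

Theorem theorem2p12 (R : realType) (d : measure_display) (Omega : measurableType d)
  (nu : {measure set Omega -> \bar R}) (knorm : nat -> R) (Pre Pim : nat -> Omega -> R)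
  (alpha : R) (m : nat) :
  chaos_model nu knorm Pre Pim -> in_Gdual knorm ->
  (0 < alpha < 1)%R ->
  (in_D2 (- (m%:R) - alpha)%R knorm <->
   ((Gamma alpha)^-1)%:E *
     \int[@lebesgue_measure R]_(l in `[0%R, 1%R[)
        (((1 - l) `^ (alpha - 1))%:E * iter_int (SPhi_sq nu Pre Pim) m l) < +oo).
Proof.
move=> chaos _ alpha01.
pose c n : R := (n`!%:R * knorm n ^+ 2)%R.
have c0 n : (0 <= c n)%R by rewrite mulr_ge0// sqr_ge0.
pose w n : R := (c n / ((n.*2 + m) ^_ m)%:R)%R.
have w0 n : (0 <= w n)%R by rewrite divr_ge0.
(* Taking [fine] loses nothing here: [beta_integral_le] makes every such integral finite, as [bE]
   records. *)
pose b n := fine (\int[@lebesgue_measure R]_(l in `[0%R, 1%R[)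
  ((1 - l) `^ (alpha - 1) * l ^+ (n.*2 + m))%:E).
have B0 n : 0 <= \int[@lebesgue_measure R]_(l in `[0%R, 1%R[)
    ((1 - l) `^ (alpha - 1) * l ^+ (n.*2 + m))%:E.
  apply: integral_ge0 => l /=; rewrite in_itv/= => /andP[l0 _].
  by rewrite lee_fin mulr_ge0 ?powR_ge0// exprn_ge0.
have b0 n : (0 <= b n)%R by rewrite fine_ge0.
have bE n : \int[@lebesgue_measure R]_(l in `[0%R, 1%R[)
    ((1 - l) `^ (alpha - 1) * l ^+ (n.*2 + m))%:E = (b n)%:E.
  rewrite fineK// ge0_fin_numE//.
  by apply: (le_lt_trans (beta_integral_le _ _ _ alpha01)); rewrite ltry.
(* The weights [w n] are the coefficients left by the m inner integrations. *)
rewrite (outer_integralE R w _ _ m w0); last first.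
  move=> l l0; apply: iter_intE => // x _; exact: SPhi_sqE.
under eq_eseriesr do rewrite bE -EFinM.
pose u n : R := (n%:R `^ (- m%:R - alpha) * c n)%R.
have -> : in_D2 (- m%:R - alpha)%R knorm = is_true (\sum_(1 <= n <oo) (u n)%:E < +oo).
  by rewrite /in_D2; under eq_eseriesr do rewrite -mulrA.
pose k : R := ((1 - expR (-1)) * m.+3%:R `^ (- m%:R - alpha))%R.
have k0 : (0 < k)%R by rewrite mulr_gt0 ?powR_gt0// subr_gt0 expR_lt1; lra.
have C0 : (0 <= 1 + alpha^-1)%R.
  by rewrite addr_ge0// invr_ge0; have /andP[/ltW] := alpha01.
apply: iff_trans (nneseries_lty_equiv R u (fun n => w n * b n)%R k _ k0 C0 _ _ _) _.
- by move=> n; rewrite mulr_ge0 ?powR_ge0.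
- by move=> n; rewrite mulr_ge0.
- move=> n n0; have /andP[lo hi] := beta_coef_bounds _ _ _ m _ alpha01 n0 (bE n).
  have uE x : (x * u n = c n * (x * n%:R `^ (- m%:R - alpha)))%R.
    by rewrite /u mulrA mulrC.
  have -> : (w n * b n = c n * (b n / ((n.*2 + m) ^_ m)%:R))%R.
    by rewrite /w mulrAC -mulrA.
  by rewrite !uE !ler_wpM2l.
(* Strict positivity matters for the converse: a zero prefactor would make the product 0 even for a
   divergent series, since 0 * +oo = 0. *)
have G0 : (0 < (Gamma alpha)^-1)%R by rewrite invr_gt0 Gamma_gt0.
set S := \sum_(n <oo) _; have S0 : 0 <= S.
  by apply: nneseries_ge0 => n _ _; rewrite lee_fin mulr_ge0.
split => [Soo|].
- by rewrite -[S]fineK ?ge0_fin_numE// -EFinM ltry.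
- by case: (S) S0 => [r _ _| |]//; rewrite ?ltry// gt0_muley.
Qed.
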